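(* Suppose demand is IID on $[0,\bar D]$ with common law $P$, the holding and shortage coefficients $h,p>0$ are constant over time, and ordering has zero fixed and per-unit costs and zero lead time. Let $\widehat s_M$ minimize over $s\in[0,\bar D]$ the empirical cost $$\widehat g_M(s)=\frac1M\sum_{j=1}^M\left[h(s-D^j)^++p(D^j-s)^+\right]$$ from pooled IID observations $D^1,\ldots,D^M\sim P$. In either the backlog or the lost-sales model with horizon $T$, for every $0<\eta<1$, with probability at least $1-\eta$, $$\sup_{x_1\in[0,\bar D]}\left[V_1^{\pi_{\widehat s_M}}(x_1)-V_1^*(x_1)\right]\le2T\max\{h,p\}\bar D\sqrt{\frac{\log(2/\eta)}{2M}}.$$ Consequently, $M\ge2\max\{h,p\}^2\bar D^2T^2\epsilon^{-2}\log(2/\eta)$ suffices for $\epsilon$-optimality (i.e. for the left-hand side to be at most $\epsilon$ with probability at least $1-\eta$).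
   Context: Inventory model. Horizon $T$; $u^+=\max\{u,0\}$. Demands $D_1,\ldots,D_T$ are IID with law $P$ on $[0,\bar D]$, $\bar D>0$. Starting period $t$ with inventory $x_t$, the retailer chooses a post-order level $y_t\ge\max\{x_t,0\}$ before observing demand and incurs $h(y_t-D_t)^++p(D_t-y_t)^+$. The next state is $y_t-D_t$ in the backlog model (demand observed) and $(y_t-D_t)^+$ in the lost-sales model (only sales $\min\{D_t,y_t\}$ observed). Terminal salvage value is zero. Feasible policies use the information then available and may randomize; $V_1^\pi(x)$ is the expected total cost over $T$ periods from initial inventory $x$ (on fresh demands independent of the offline data), and $V_1^*(x)=\inf_\pi V_1^\pi(x)$. $\pi_s$ is the stationary base-stock policy with level $s\in[0,\bar D]$: it chooses post-order level $\max\{x,s\}$ at state $x$ in every period. Logarithms are natural. *)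

(* Defs.v *)
From HB Require Import structures.
From mathcomp Require Import all_boot all_order all_algebra.
From mathcomp Require Import all_classical all_reals all_analysis.
From mathcomp Require Import measurable_realfun.

Set Implicit Arguments.
Unset Strict Implicit.
Unset Printing Implicit Defensive.

Import Order.TTheory GRing.Theory Num.Theory.
Import numFieldNormedType.Exports.

Local Open Scope classical_set_scope.
Local Open Scope ring_scope.

Inductive inventory_model := Backlog | LostSales.

Section inventory.
Context {R : realType}.
Implicit Types (m : inventory_model) (x y s u : R).

Definition cost (h p : R) y u : R := h * Num.max (y - u) 0 + p * Num.max (u - y) 0.

Definition next_state m y u : R :=
  match m with Backlog => y - u | LostSales => Num.max (y - u) 0 end.

(* What the retailer sees of the demand u: u itself under backlogging, only the
   sales when excess demand is lost. *)
Definition observation m y u : R :=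
  match m with Backlog => u | LostSales => Num.min u y end.

(* One past period: (pre-order inventory, post-order level, third component),
   where the third component is the demand in a trajectory and its observation
   in the retailer's information. Tuples list the most recent period first. *)
Definition period : Type := (R * R * R)%type.

Definition observe m (r : period) : period :=
  (r.1, observation m r.1.2 r.2).

(* Information when t periods have elapsed: the t past observed periods and the
   current inventory. *)
Definition info (t : nat) : Type := (t.-tuple period * R)%type.

(* A history-dependent randomized policy: the post-order level chosen after t
   elapsed periods is drawn from a probability kernel on the information. *)
Definition policy : Type :=
  forall t : nat, R.-pker (info t) ~> R.

Definition feasible (pi : policy) : Prop :=
  forall (t : nat) (i : info t), pi t i [set y | Num.max i.2 0 <= y] = 1%E.

Lemma measurable_base_stock s (t : nat) :
  measurable_fun [set: info t] (fun i : info t => Num.max i.2 s).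
Proof. by apply: measurable_maxr => //; exact: measurable_snd. Qed.

Definition base_stock s : policy := fun t => kdirac (@measurable_base_stock s t).

Lemma base_stock_feasible s : 0 <= s -> feasible (base_stock s).
Proof.
move=> s0 t i; rewrite /base_stock /kdirac/= diracE mem_set//=.
by rewrite ge_max !le_max lexx s0 orbT.
Qed.

(* Expectation of F(trajectory) under the law of the next n periods induced by
   pi when the demands are IID with law P, given the t past periods w and the
   current inventory x. *)
Fixpoint expect_trajectory m (P : probability R R) (pi : policy)
    (F : seq period -> \bar R) (n t : nat) (w : t.-tuple period) x : \bar R :=
  if n is n'.+1 then
    (\int[pi t ([tuple of map (observe m) w], x)]_y \int[P]_u
       expect_trajectory m P pi F n' [tuple of (x, y, u) :: w]
         (next_state m y u))%E
  else F w.

Definition total_cost (h p : R) (w : seq period) : R :=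
  \sum_(r <- w) cost h p r.1.2 r.2.

Definition policy_value m (P : probability R R) (h p : R) (T : nat)
    (pi : policy) x : \bar R :=
  expect_trajectory m P pi (fun w => (total_cost h p w)%:E) T [tuple] x.

Definition optimal_value m (P : probability R R) (h p : R) (T : nat) x
    : \bar R :=
  ereal_inf [set policy_value m P h p T pi x | pi in feasible].

Definition worst_regret m (P : probability R R) (h p Dbar : R) (T : nat)
    (pi : policy) : \bar R :=
  ereal_sup [set (policy_value m P h p T pi x - optimal_value m P h p T x)%E
            | x in `[0, Dbar]%classic].

Definition empirical_cost (h p : R) (M : nat) (D : 'I_M -> R) s : R :=
  M%:R^-1 * \sum_(j < M) cost h p s (D j).

Definition minimizes (A : set R) (g : R -> R) s : Prop :=
  A s /\ forall s', A s' -> g s <= g s'.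

Section sampling.
Context d (Omega : measurableType d) (Q : probability Omega R).

Definition mutually_independent (M : nat) (D : 'I_M -> {RV Q >-> R}) : Prop :=
  forall (J : {set 'I_M}) (B : 'I_M -> set R), (forall j, measurable (B j)) ->
    Q (\bigcap_(j in [set j | j \in J]) (D j @^-1` B j)) =
    (\prod_(j in J) Q (D j @^-1` B j))%E.

Definition iid_sample (P : probability R R) (M : nat)
    (D : 'I_M -> {RV Q >-> R}) : Prop :=
  mutually_independent D /\
  forall j (B : set R), measurable B -> distribution Q (D j) B = P B.

(* Inner probability, since an arbitrary selection of minimizers need not be
   measurable. *)
Definition with_probability_at_least (r : R) (E : set Omega) : Prop :=
  exists A : set Omega, [/\ measurable A, A `<=` E & (r%:E <= Q A)%E].

Lemma with_probability_at_leastE r (E : set Omega) : measurable E ->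
  with_probability_at_least r E <-> (r%:E <= Q E)%E.
Proof.
move=> mE; split=> [[A [mA AE rA]]|rE]; last by exists E; split.
by apply: le_trans rA _; apply: le_measure AE; rewrite inE.
Qed.

End sampling.
End inventory.

(* Main.v *)
Require Import Defs.
From HB Require Import structures.
From mathcomp Require Import all_boot all_order all_algebra.
From mathcomp Require Import all_classical all_reals all_analysis.
From mathcomp Require Import measurable_realfun ring lra.

(** Regret reduces to the one-period cost.  Let g(y) be the expected one-period
    cost and sopt a minimizer of g.  Under any feasible policy the order-up-to
    level after demands D_1, ..., D_k is at least x - D_1 - ... - D_k, and g is
    nondecreasing to the right of sopt, so every policy pays at least
    g (max (x - D_1 - ... - D_k) sopt) in expectation in each period, while the
    base-stock policy s pays exactly the same expression with s for sopt.  Hence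
    the regret of s is at most T (g(s) - g(sopt)), in both models.

    No uniform deviation bound (DKW) is needed to control g(shat) - g(sopt).
    Fix r > sopt with g(r) = g(sopt) + eps.  If shat > sopt and
    g(shat) > g(r), then shat > r, and convexity of the empirical cost forces its
    value at r to be at most its value at sopt.  Hoeffding's inequality for
    cost(sopt, D) - cost(r, D), whose range has length at most (h + p) Dbar,
    bounds the probability of this event; the case shat < sopt is symmetric. *)

Set Implicit Arguments.
Unset Strict Implicit.
Unset Printing Implicit Defensive.

Import Order.TTheory GRing.Theory Num.Theory.
Import numFieldNormedType.Exports.

Local Open Scope classical_set_scope.
Local Open Scope ring_scope.

(** * Hoeffding's inequality *)

(** By the mean value theorem. Two applications carry the sign of a second derivative over to the
    function. *)
Lemma ge0_derive_ge0 (R : realType) (f df : R -> R) :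
  (forall x, is_derive (x : R) (1 : R) f (df x)) ->
  (forall x, 0 <= x -> 0 <= df x) ->
  f 0 = 0 -> forall x, 0 <= x -> 0 <= f x.
Proof.
move=> dfE df_ge0 f0 x x_ge0.
have cf : {within `[0, x], continuous f}.
  apply: derivable_within_continuous => y _.
  exact: (@ex_derive _ _ _ _ _ _ _ (dfE y)).
have [c /itvP c0x] := MVT_segment x_ge0 (fun y _ => dfE y) cf.
by rewrite f0 !subr0 => ->; rewrite mulr_ge0 ?df_ge0 ?c0x.
Qed.

(** Let [psi] be the right-hand exponent minus the logarithm of the left side. Both [psi] and its
    derivative vanish at 0, and its second derivative is nonnegative, so [psi t >= 0]. *)
Lemma bernoulli_mgf_le (R : realType) (q t : R) : 0 <= q <= 1 -> 0 <= t ->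
  1 - q + q * expR t <= expR (q * t + t ^+ 2 / 8).
Proof.
move=> /andP[q_ge0 q_le1] t_ge0.
pose m (x : R) := 1 - q + q * expR x.
have m_gt0 x : 0 < m x.
  rewrite /m; have := expR_gt0 x => ex.
  have [->|q_neq0] := eqVneq q 0; first by rewrite mul0r subr0 addr0.
  rewrite ltr_wpDl ?subr_ge0// mulr_gt0// lt_neqAle eq_sym q_neq0//=.
have dm x : is_derive x (1 : R) m (q * expR x).
  rewrite /m; apply: is_derive_eq; rewrite /GRing.scale/=; ring.
(* [r x] is the success probability of the exponentially tilted Bernoulli law; its derivative is the
   variance of that law, hence at most 1/4. *)
pose r (x : R) := q * expR x / m x.
have dr x : is_derive x (1 : R) r (r x * (1 - r x)).
  have mV : is_derive (x : R) (1 : R) (fun y => (m y)^-1)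
      (- m x ^- 2 *: (q * expR x)).
    by apply: is_deriveV => //; rewrite gt_eqF.
  rewrite /r; apply: is_derive_eq; rewrite /GRing.scale/=.
  by field; rewrite gt_eqF.
pose psi (x : R) := q * x + x ^+ 2 / 8 - ln (m x).
pose dpsi (x : R) := q + x / 4 - r x.
have dpsiE x : is_derive x (1 : R) psi (dpsi x).
  have lnm : is_derive x (1 : R) (@ln R \o m) ((m x)^-1 * (q * expR x)).
    apply: is_derive1_comp => //; exact: is_derive1_ln.
  rewrite /psi; apply: is_derive_eq; rewrite /GRing.scale/= /dpsi /r.
  by field; rewrite gt_eqF.
have ddpsiE x : is_derive x (1 : R) dpsi (1 / 4 - r x * (1 - r x)).
  rewrite /dpsi; apply: is_derive_eq; rewrite /GRing.scale/=.
  by field.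
have dpsi_ge0 : forall x, 0 <= x -> 0 <= dpsi x.
  apply: (ge0_derive_ge0 ddpsiE) => [y _|].
    by have := sqr_ge0 (r y - 1 / 2); nra.
  by rewrite /dpsi /r /m expR0 mulr1 subrK mul0r addr0 divr1 subrr.
have := ge0_derive_ge0 dpsiE dpsi_ge0 _ t_ge0.
rewrite {1}/psi/m expR0 mulr1 subrK ln1 mulr0 expr0n/= mul0r !addr0 subr0.
move=> /(_ erefl); rewrite subr_ge0 -ler_expR lnK// posrE.
exact: m_gt0.
Qed.

(** * Expectations of products of independent factors *)

Section factorization.
Local Open Scope ereal_scope.
Context d d' (T : measurableType d) (T' : measurableType d') (R : realType).
Variables (Q : {measure set T -> \bar R}) (P : {measure set T' -> \bar R}).
Variables (W : T -> R) (X : T -> T') (c : R).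
Hypotheses (mW : measurable_fun [set: T] W) (W_ge0 : forall w, (0 <= W w)%R).
Hypotheses (mX : measurable_fun [set: T] X) (c_ge0 : (0 <= c)%R).
Hypothesis indicE : forall B, measurable B ->
  \int[Q]_w ((W w)%:E * (\1_B (X w))%:E) = c%:E * P B.

Import HBNNSimple.

Let factorization_nnsfun (g : {nnsfun T' >-> R}) :
  \int[Q]_w ((W w)%:E * (g (X w))%:E) = c%:E * \int[P]_x (g x)%:E.
Proof.
have mB r : measurable (g @^-1` [set r]) by [].
have mI r : measurable_fun [set: T]
    (fun w => (\1_(g @^-1` [set r]) (X w))%:E : \bar R).
  apply/measurable_EFinP; apply: measurableT_comp => //.
transitivity (\int[Q]_w \sum_(r \in range g)
    (r%:E * ((W w)%:E * (\1_(g @^-1` [set r]) (X w))%:E))).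
  apply: eq_integral => w _; rewrite [in LHS]fimfunE -fsumEFin//.
  rewrite ge0_mule_fsumr; last by move=> r; rewrite EFinM nnfun_muleindic_ge0.
  by apply: eq_fsbigr => r _; rewrite EFinM muleCA.
rewrite ge0_integral_fsum//; last 2 first.
- move=> r; apply: measurable_funeM; apply: emeasurable_funM => //.
  exact/measurable_EFinP.
- move=> r w _; rewrite muleCA; apply: mule_ge0; first by rewrite lee_fin.
  exact: nnfun_muleindic_ge0.
(* Distributing [c] over the sum needs nonnegative terms; for negative [r] the fibre of [g] is
   empty. *)
rewrite integralT_nnsfun sintegralE ge0_mule_fsumr; last first.
  move=> r; have [r_ge0|r_lt0] := leP 0%R r; first by rewrite mule_ge0// lee_fin.
  by rewrite preimage_nnfun0// measure0 mule0.
apply: eq_fsbigr => r /[!inE] -[x _ gxr].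
rewrite ge0_integralZl//.
- by rewrite indicE// muleCA.
- by apply: emeasurable_funM => //; exact/measurable_EFinP.
- by move=> w _; rewrite mule_ge0// lee_fin.
- by rewrite lee_fin -gxr.
Qed.

(** The hypothesis on indicators extends to simple functions by linearity and then to [f] by
    monotone convergence. *)
Lemma ge0_integral_factor (f : T' -> \bar R) : measurable_fun [set: T'] f ->
  (forall x, 0 <= f x) ->
  \int[Q]_w ((W w)%:E * f (X w)) = c%:E * \int[P]_x f x.
Proof.
move=> mf f_ge0; pose f_ := nnsfun_approx measurableT mf.
have f_cvg x : (f_ n x)%:E @[n --> \oo] --> f x by exact: cvg_nnsfun_approx.
have f_nd x m n : (m <= n)%N -> (f_ m x <= f_ n x)%R.
  by move=> mn; exact/lefP/nd_nnsfun_approx.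
transitivity (limn (fun n => \int[Q]_w ((W w)%:E * (f_ n (X w))%:E))).
  rewrite -monotone_convergence//.
  - apply: eq_integral => w _; apply/esym/cvg_lim => //.
    exact: cvgeZl.
  - move=> n; apply: emeasurable_funM => //; apply/measurable_EFinP => //.
    exact: measurableT_comp.
  - by move=> n w _; rewrite mule_ge0// lee_fin.
  - by move=> w _ m n mn; rewrite lee_wpmul2l ?lee_fin ?f_nd.
under eq_fun do rewrite factorization_nnsfun.
have -> : \int[P]_x f x = limn (fun n => \int[P]_x (f_ n x)%:E).
  rewrite -monotone_convergence//.
  - by apply: eq_integral => x _; apply/esym/cvg_lim.
  - by move=> n; apply/measurable_EFinP.
  - by move=> n x _; rewrite lee_fin.
  - by move=> x _ m n mn; rewrite lee_fin f_nd.
apply: limeMl => //; apply: ereal_nondecreasing_is_cvgn => m n mn.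
by apply: ge0_le_integral => //= [x _|||x _]; rewrite ?lee_fin ?f_nd//;
  exact/measurable_EFinP.
Qed.
End factorization.

Lemma measurable_prod_fun d (T : measurableType d) (R : realType) (I : Type)
    (s : seq I) (A : pred I) (F : I -> T -> R) :
  (forall i, measurable_fun [set: T] (F i)) ->
  measurable_fun [set: T] (fun x => \prod_(i <- s | A i) F i x).
Proof.
move=> mF; elim: s => [|i s IHs].
  by under eq_fun do rewrite big_nil; exact: measurable_cst.
under eq_fun do rewrite big_cons.
by case: (A i) => //; exact: measurable_funM.
Qed.

Section iid.
Context (R : realType) (P : probability R R).
Context d (Omega : measurableType d) (Q : probability Omega R).
Context (M : nat) (D : 'I_M -> {RV Q >-> R}).
Hypothesis D_iid : iid_sample P D.

(** Independence is given for events, that is, for products of indicators. The factors become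
    general functions one at a time through [ge0_integral_factor], with the product of the other
    factors as the weight. *)
Lemma iid_integral_prod (g : 'I_M -> R -> R) (e : 'I_M -> R) :
  (forall j, measurable_fun [set: R] (g j)) -> (forall j x, 0 <= g j x) ->
  (forall j, \int[P]_x (g j x)%:E = (e j)%:E)%E ->
  (\int[Q]_w (\prod_j g j (D j w))%:E = (\prod_j e j)%:E)%E.
Proof.
have mD j : measurable_fun [set: Omega] (D j) by [].
(* Induction on the number k of factors that are not indicator functions. *)
suff step k : forall (g : 'I_M -> R -> R) (e : 'I_M -> R),
    (forall j, measurable_fun [set: R] (g j)) ->
    (forall j x, 0 <= g j x) ->
    (forall j, \int[P]_x (g j x)%:E = (e j)%:E)%E ->
    (forall j : 'I_M, (k <= j)%N -> exists2 B, measurable B & g j = \1_B) ->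
    (\int[Q]_w (\prod_j g j (D j w))%:E = (\prod_j e j)%:E)%E.
  move=> mg g_ge0 eE; apply: (step M) => // j.
  by rewrite leqNgt ltn_ord.
elim: k => {g e} [g e mg g_ge0 eE g_indic|k IHk g e mg g_ge0 eE g_indic].
  have /choice[B BE] : forall j, exists B, measurable B /\ g j = \1_B.
    by move=> j; have [B ? ?] := g_indic j (leq0n _); exists B.
  have mB j : measurable (D j @^-1` B j).
    rewrite -[X in measurable X]setTI; apply: mD => //; exact: (BE j).1.
  have prod_indic w : \prod_j g j (D j w) =
      \1_(\bigcap_(j in [set j | j \in [set: 'I_M]%SET]) (D j @^-1` B j)) w.
    rewrite indicE; case: (boolP (_ \in _)) => [/set_mem inB|/negP ninB].
      rewrite big1// => j _; rewrite (BE j).2 indicE mem_set//.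
      by apply: inB; rewrite /= inE.
    have [j jB] : exists j, ~ B j (D j w).
      apply: contrapT => /forallNP h; apply/ninB/mem_set => j _.
      by apply: contrapT; exact: h.
    by rewrite (bigD1 j)//= (BE j).2 indicE memNset// mul0r.
  under eq_integral do rewrite prod_indic.
  rewrite integral_indic//; last first.
    by apply: fin_bigcap_measurable => // j _; exact: mB.
  rewrite setIT; etransitivity.
    by apply: (D_iid.1 [set: 'I_M]%SET B) => j; exact: (BE j).1.
  rewrite -prodEFin; apply: eq_big => [j|j _]; first by rewrite inE.
  rewrite -eE (BE j).2 integral_indic//; last exact: (BE j).1.
  by rewrite setIT; apply: (D_iid.2 j); exact: (BE j).1.
have [kM|Mk] := ltnP k M; last first.
  by apply: IHk => // j kj; have := leq_trans Mk kj; rewrite leqNgt ltn_ord.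
pose K := Ordinal kM.
pose W w := \prod_(j | j != K) g j (D j w).
pose c := \prod_(j | j != K) e j.
have e_ge0 j : 0 <= e j.
  by rewrite -lee_fin -eE; apply: integral_ge0 => x _; rewrite lee_fin.
under eq_integral => w _ do rewrite (bigD1 K)//= mulrC EFinM.
rewrite (bigD1 K)//= mulrC EFinM -eE.
apply: (ge0_integral_factor (X := D K) (P := P)) => //.
- by apply: measurable_prod_fun => j; exact: measurableT_comp.
- by move=> w; rewrite /W; apply: prodr_ge0.

(* With an indicator in place of factor [K], only indices below [k] carry general functions, so the
   induction hypothesis applies. *)
- move=> B mB; pose g' j := if j == K then \1_B else g j.
  pose e' j := if j == K then fine (P B) else e j.
  have := IHk g' e'.
  have -> : (\prod_j e' j)%:E = ((\prod_(j | j != K) e j)%:E * P B)%E.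
    rewrite (bigD1 K)//= {1}/e' eqxx mulrC EFinM fineK ?fin_num_measure//.
    by congr (_%:E * _)%E; apply: eq_bigr => j /negPf jK; rewrite /e' jK.
  move=> <-.
  + apply: eq_integral => w _; rewrite [in RHS](bigD1 K)//= {1}/g' eqxx mulrC EFinM.
    by congr (_%:E * _)%E; apply: eq_bigr => j /negPf jK; rewrite /g' jK.
  + move=> j; rewrite /g'; case: eqP => // _; exact: measurable_indic.
  + move=> j x; rewrite /g'; case: eqP => // _.
  + move=> j; rewrite /g' /e'; case: eqP => // _.
    by rewrite integral_indic// setIT fineK ?fin_num_measure.
  + move=> j; rewrite /g'; case: eqP => [_ _|/eqP jK kj]; first by exists B.
    by apply: g_indic; rewrite ltn_neqAle kj andbT eq_sym.
- exact/measurable_EFinP.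
- by move=> x; rewrite lee_fin.
Qed.
End iid.

(** The tangent of the exponential at [q * t], evaluated at 0 and [t] with weights [1 - q] and [q],
    averages to the value at the point of contact. *)
Lemma expR_chord_le (R : realType) (q t : R) : 0 <= q <= 1 ->
  expR (q * t) <= 1 - q + q * expR t.
Proof.
move=> /andP[q_ge0 q_le1]; set x := q * t.
have ex := expR_gt0 x.
have tangent y : expR x * (1 + (y - x)) <= expR y.
  rewrite -[y in leRHS](subrKC x) expRD ler_pM2l//; exact: expR_ge1Dx.
have h0 := tangent 0; have ht := tangent t.
rewrite expR0 in h0.
have -> : expR x = (1 - q) * (expR x * (1 + (0 - x)))
    + q * (expR x * (1 + (t - x))) by rewrite /x; ring.
apply: lerD; last by rewrite ler_wpM2l.
by rewrite -[leRHS]mulr1 ler_wpM2l ?subr_ge0.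
Qed.

(** * Integrals of bounded functions *)

Section bounded_integrable.
Context d (T : measurableType d) (R : realType) (P : probability T R).

Lemma bounded_integrable (f : T -> R) (b : R) : measurable_fun [set: T] f ->
  (forall x, `|f x| <= b) -> P.-integrable [set: T] (EFin \o f).
Proof.
move=> mf f_le; apply: measurable_bounded_integrable => //.
- by rewrite (le_lt_trans (probability_le1 _ _)) ?ltry.
- exists b; split; first exact: num_real.
  by move=> y by_ x _; rewrite /= (le_trans (f_le x))// ltW.
Qed.

Lemma Rintegral_cst1 (u : R) : \int[P]_x u = u.
Proof.
rewrite Rintegral_cst// (_ : fine _ = 1) ?mulr1//.
by rewrite -[RHS]/(fine 1%:E); congr fine; exact: probability_setT.
Qed.

Lemma integrable_cst1 (u : R) : P.-integrable [set: T] (EFin \o (fun=> u)).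
Proof.
by apply: (@bounded_integrable _ `|u|) => //; exact: measurable_cst.
Qed.

Lemma Rintegral_bounds (f : T -> R) (a b : R) :
  P.-integrable [set: T] (EFin \o f) -> (forall x, a <= f x <= b) ->
  a <= \int[P]_x f x <= b.
Proof.
move=> fi f_ab; rewrite -[leLHS]Rintegral_cst1 -[X in _ <= _ <= X]Rintegral_cst1.
by apply/andP; split; apply: le_Rintegral => //;
  [exact: integrable_cst1| |exact: integrable_cst1|] => x _;
  have /andP[] := f_ab x.
Qed.

Lemma Rintegral_affine (f : T -> R) (u v : R) :
  P.-integrable [set: T] (EFin \o f) ->
  (\int[P]_x (u + v * f x) = u + v * \int[P]_x f x)%R.
Proof.
move=> fi.
have ui := integrable_cst1 u.
have vi : P.-integrable [set: T] (EFin \o (fun x => v * f x)).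
  exact: (integrableZl measurableT v fi).
by rewrite RintegralD// RintegralZl// Rintegral_cst1.
Qed.
End bounded_integrable.

(** * Exponential moments and tail bounds *)

Section hoeffding_lemma.
Context d (T : measurableType d) (R : realType) (P : probability T R).

(** The chord over [[a, a + b]] dominates the exponential and is affine in [f], so only the mean [m]
    of [f] enters. This leaves a Bernoulli variable of mean [(m - a) / b] with parameter [l * b]. *)
Lemma hoeffding_mgf (f : T -> R) (a b l : R) : measurable_fun [set: T] f ->
  0 < b -> (forall x, a <= f x <= a + b) -> 0 <= l ->
  \int[P]_x expR (l * (f x - \int[P]_x f x)) <= expR ((l * b) ^+ 2 / 8).
Proof.
move=> mf b_gt0 f_ab l_ge0; set m := \int[P]_x f x.
have fi : P.-integrable [set: T] (EFin \o f).
  apply: (@bounded_integrable _ _ _ _ _ (`|a| + b)) => // x.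
  have /andP[ax xb] := f_ab x; rewrite ler_norml.
  by have := ler_norm a; have := ler_norm (- a); rewrite normrN; lra.
pose th x := (f x - a) / b.
have th01 x : 0 <= th x <= 1.
  have /andP[ax xb] := f_ab x.
  by rewrite /th divr_ge0 ?subr_ge0 ?(ltW b_gt0)//= ler_pdivrMr// mul1r lerBlDl.
pose C := expR (l * (a - m)).
have C_ge0 : 0 <= C by exact: expR_ge0.
have chord x : expR (l * (f x - m)) <= C * (1 - th x + th x * expR (l * b)).
  have -> : l * (f x - m) = l * (a - m) + th x * (l * b).
    by rewrite /th; field; rewrite gt_eqF.
  by rewrite expRD ler_wpM2l// expR_chord_le.
pose v := C * (expR (l * b) - 1) / b.
have affE x : C * (1 - th x + th x * expR (l * b)) = (C - v * a) + v * f x.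
  by rewrite /v /th; field; rewrite gt_eqF.
have mth : 0 <= (m - a) / b <= 1.
  have /andP[am mb] := Rintegral_bounds fi f_ab.
  by rewrite divr_ge0 ?subr_ge0 ?(ltW b_gt0)//= ler_pdivrMr// mul1r lerBlDl.
apply: (@le_trans _ _ (\int[P]_x ((C - v * a) + v * f x))).
  apply: le_Rintegral => //.
  - apply: (@bounded_integrable _ _ _ _ _ (expR (l * (a + b - m)))).
      apply: measurableT_comp => //; apply: measurable_funM => //.
      exact: measurable_funB.
    move=> x; rewrite ger0_norm ?expR_ge0// ler_expR ler_wpM2l// lerB//.
    by have /andP[] := f_ab x.
  - have vi : P.-integrable [set: T] (EFin \o (fun x => v * f x)).
      exact: (integrableZl measurableT v fi).
    exact: (integrableD measurableT (integrable_cst1 P (C - v * a)) vi).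
  - by move=> x _; rewrite -affE chord.
rewrite Rintegral_affine// -/m.
have -> : C - v * a + v * m = C * (1 - (m - a) / b + (m - a) / b * expR (l * b)).
  by rewrite /v; field; rewrite gt_eqF.
apply: (le_trans (ler_wpM2l C_ge0 (bernoulli_mgf_le mth _))).
  by rewrite mulr_ge0// ltW.
(* The linear term [l * (m - a)] of the Bernoulli exponent cancels against the factor [C]. *)
rewrite -expRD ler_expR le_eqVlt; apply/orP; left; apply/eqP.
by field; rewrite gt_eqF.
Qed.
End hoeffding_lemma.

Section hoeffding_tail.
Context (R : realType) (P : probability R R).
Context d (Omega : measurableType d) (Q : probability Omega R).
Context (M : nat) (D : 'I_M -> {RV Q >-> R}).

Lemma measurable_sum_ge (f : R -> R) (c : R) : measurable_fun [set: R] f ->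
  measurable [set w | c <= \sum_j f (D j w)].
Proof.
move=> mf; rewrite (_ : [set w | _] =
    setT `&` (fun w => \sum_j f (D j w)) @^-1` `[c, +oo[).
  by apply: measurable_sum => // j; exact: measurableT_comp.
by rewrite setTI; apply/seteqP; split => w; rewrite /= in_itv/= andbT.
Qed.

Hypothesis D_iid : iid_sample P D.

(** Chernoff's method: an exponential dominates the indicator of the event, its mean factorizes by
    independence, and [hoeffding_mgf] bounds each factor. *)
Lemma hoeffding_tail (f : R -> R) (a b eps : R) :
  measurable_fun [set: R] f -> 0 < b -> (forall x, a <= f x <= a + b) ->
  0 <= eps ->
  (Q [set w | (M%:R * (\int[P]_x f x + eps) <= \sum_j f (D j w))%R] <=
     (expR (- (2 * M%:R * eps ^+ 2 / b ^+ 2)))%:E)%E.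
Proof.
move=> mf b_gt0 f_ab eps_ge0; set m := \int[P]_x f x; set A := [set w | _].
have mD j : measurable_fun [set: Omega] (D j) by [].
(* This l minimizes the exponent (l * b) ^+ 2 / 8 - l * eps. *)
pose l := 4 * eps / b ^+ 2.
have l_ge0 : 0 <= l by rewrite divr_ge0 ?sqr_ge0 ?mulr_ge0.
pose g x := expR (l * (f x - m)).
have mg : measurable_fun [set: R] g.
  apply: measurableT_comp => //; apply: measurable_funM => //.
  exact: measurable_funB.
have gi : P.-integrable [set: R] (EFin \o g).
  apply: (@bounded_integrable _ _ _ _ _ (expR (l * (a + b - m)))) => // x.
  rewrite ger0_norm ?expR_ge0// ler_expR ler_wpM2l// lerB//.
  by have /andP[] := f_ab x.
set e := \int[P]_x g x.
have gE : (\int[P]_x (g x)%:E = e%:E)%E.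
  by rewrite /e /Rintegral fineK ?integrable_fin_num.
have e_ge0 : 0 <= e by apply: Rintegral_ge0 => x _; exact: expR_ge0.
pose k := expR (- (l * (M%:R * eps))).
have k_ge0 : 0 <= k by exact: expR_ge0.
have mprod : measurable_fun [set: Omega] (fun w => \prod_j g (D j w)).
  by apply: measurable_prod_fun => j; exact: measurableT_comp.
have mA : measurable A by exact: measurable_sum_ge.
have le_k w : \1_A w <= k * \prod_j g (D j w).
  rewrite indicE; case: (boolP (w \in A)) => [/set_mem Aw|_]; last first.
    by rewrite mulr_ge0// prodr_ge0// => j _; exact: expR_ge0.
  rewrite -expR_sum -expRD -[leLHS]expR0 ler_expR -mulr_sumr -mulrN -mulrDr.
  rewrite mulr_ge0// sumrB sumr_const card_ord -[m *+ M]mulr_natl.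
  by move: Aw; rewrite /A/= mulrDr; lra.
rewrite -[A]setIT -integral_indic//.
apply: (@le_trans _ _ (\int[Q]_w (k%:E * (\prod_j g (D j w))%:E))%E).
  apply: ge0_le_integral => //=.
  - exact/measurable_EFinP/measurable_indic.
  - by apply: measurable_funeM; exact/measurable_EFinP.
  - by move=> w _; rewrite -EFinM lee_fin.
rewrite ge0_integralZl//; last 2 first.
- exact/measurable_EFinP.
- by move=> w _; rewrite lee_fin prodr_ge0// => j _; exact: expR_ge0.
rewrite (iid_integral_prod D_iid (g := fun=> g) (e := fun=> e))//; last first.
  by move=> j x; exact: expR_ge0.
rewrite prodr_const card_ord -EFinM lee_fin.
have e_le : e <= expR ((l * b) ^+ 2 / 8).
  exact: (hoeffding_mgf P mf b_gt0 f_ab l_ge0).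
apply: (@le_trans _ _ (k * expR ((l * b) ^+ 2 / 8) ^+ M)).
  by rewrite ler_wpM2l// lerXn2r// nnegrE// expR_ge0.
rewrite -expRM_natl -expRD ler_expR le_eqVlt; apply/orP; left; apply/eqP.
by rewrite /l; field; rewrite gt_eqF.
Qed.
End hoeffding_tail.

(** * One-period costs *)

(** Convexity is multiplied out by [c - a], which avoids division when [a = c]. Later arguments use
    the resulting quasiconvexity, for both the empirical and the expected cost. *)
Lemma le_max_of_convex (R : realFieldType) (f : R -> R) (a b c : R) :
  a <= b -> b <= c ->
  (c - a) * f b <= (c - b) * f a + (b - a) * f c ->
  f b <= Num.max (f a) (f c).
Proof.
move=> ab bc; have [ac|ac] := eqVneq a c.
  by rewrite le_max (_ : b = a) ?lexx//; apply/le_anti; rewrite ab ac bc.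
have ca_gt0 : 0 < c - a by rewrite subr_gt0 lt_neqAle ac (le_trans ab).
set k := Num.max _ _.
have fak : f a <= k by rewrite le_max lexx.
have fck : f c <= k by rewrite le_max lexx orbT.
have := ler_wpM2l (_ : 0 <= c - b) fak; rewrite subr_ge0 => /(_ bc).
have := ler_wpM2l (_ : 0 <= b - a) fck; rewrite subr_ge0 => /(_ ab).
by move=> h1 h2 h3; rewrite -(ler_pM2l ca_gt0); lra.
Qed.

Section cost.
Context (R : realType) (h p : R) (h_gt0 : 0 < h) (p_gt0 : 0 < p).

Lemma cost_ge0 y u : 0 <= cost h p y u.
Proof. by rewrite addr_ge0 ?mulr_ge0 ?le_max ?lexx ?orbT ?ltW. Qed.

Lemma measurable_cost : measurable_fun [set: R * R] (fun z => cost h p z.1 z.2).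
Proof.
by apply: measurable_funD; apply: measurable_funM => //;
  apply: measurable_maxr => //; apply: measurable_funB.
Qed.

Lemma measurable_cost_demand y : measurable_fun [set: R] (cost h p y).
Proof.
by apply: measurable_funD; apply: measurable_funM => //;
  apply: measurable_maxr => //; apply: measurable_funB.
Qed.

(** Raising the level from [s] to [r] adds at most [h * (r - s)] of holding cost and saves at most
    [p * (r - s)] of shortage cost. The bounds hold for every real [u], so they supply the range in
    Hoeffding's inequality without reference to the support. *)
Lemma cost_diff_bounds s r u : s <= r ->
  - (h * (r - s)) <= cost h p s u - cost h p r u <= p * (r - s).
Proof.
move=> sr.
have pos_diff (v w : R) : v <= w -> 0 <= Num.max w 0 - Num.max v 0 <= w - v.
  by move=> vw; case: (leP v 0) => ?; case: (leP w 0) => ?; lra.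
have /andP[h1_ge0 h1_le] := pos_diff _ _ (lerB sr (lexx u)).
have /andP[p1_ge0 p1_le] := pos_diff _ _ (lerB (lexx u) sr).
rewrite /cost; set v := Num.max (r - u) 0 in h1_ge0 h1_le *.
set v' := Num.max (s - u) 0 in h1_ge0 h1_le *.
set w := Num.max (u - s) 0 in p1_ge0 p1_le *.
set w' := Num.max (u - r) 0 in p1_ge0 p1_le *.
have := ler_wpM2l (ltW h_gt0) h1_ge0; have := ler_wpM2l (ltW h_gt0) h1_le.
have := ler_wpM2l (ltW p_gt0) p1_ge0; have := ler_wpM2l (ltW p_gt0) p1_le.
by lra.
Qed.

Lemma cost_convex a b c u : a <= b -> b <= c ->
  (c - a) * cost h p b u <= (c - b) * cost h p a u + (b - a) * cost h p c u.
Proof.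
move=> ab bc.
have pos_convex (x y z : R) : (c - a) * y = (c - b) * x + (b - a) * z ->
    (c - a) * Num.max y 0 <= (c - b) * Num.max x 0 + (b - a) * Num.max z 0.
  move=> yE; rewrite maxr_pMr ?subr_ge0 ?(le_trans ab)// mulr0 ge_max yE.
  by rewrite lerD ?addr_ge0 ?mulr_ge0 ?ler_wpM2l ?subr_ge0 ?le_max ?lexx ?orbT.
have := ler_wpM2l (ltW h_gt0) (pos_convex (a - u) (b - u) (c - u) _).
have := ler_wpM2l (ltW p_gt0) (pos_convex (u - a) (u - b) (u - c) _).
rewrite /cost => /(_ ltac:(ring)) ? /(_ ltac:(ring)) ?; lra.
Qed.

(** Clipping a level to [[0, Dbar]] moves it towards every demand in that interval without passing
    it. *)
Lemma cost_outside_support Dbar y u : 0 <= u <= Dbar ->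
  cost h p (Num.min (Num.max y 0) Dbar) u <= cost h p y u.
Proof.
move=> /andP[u0 uD].
have D_ge0 := le_trans u0 uD; rewrite /cost.
have [y0|/ltW y0] := leP y 0.
  rewrite (min_l D_ge0) (max_r (_ : 0 - u <= 0)) ?subr_le0//.
  rewrite (max_r (_ : y - u <= 0)) ?subr_le0 ?(le_trans y0)//.
  by rewrite !max_l ?subr_ge0 ?(le_trans y0)// lerD// ler_wpM2l ?(ltW p_gt0)// lerB.
have [yD|/ltW yD] := leP y Dbar; first by rewrite lexx.
rewrite (max_r (_ : u - Dbar <= 0)) ?subr_le0//.
rewrite (max_r (_ : u - y <= 0)) ?subr_le0 ?(le_trans uD)//.
by rewrite !max_l ?subr_ge0 ?(le_trans uD)// lerD// ler_wpM2l ?(ltW h_gt0)// lerB.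
Qed.
End cost.

Lemma empirical_cost_between (R : realType) (h p : R) (M : nat) (D : 'I_M -> R)
    (a b c : R) : 0 < h -> 0 < p -> a <= b -> b <= c ->
  empirical_cost h p D b
    <= Num.max (empirical_cost h p D a) (empirical_cost h p D c).
Proof.
move=> h_gt0 p_gt0 ab bc; apply: le_max_of_convex => //; rewrite /empirical_cost.
rewrite !(mulrCA _ M%:R^-1) -mulrDr ler_wpM2l ?invr_ge0//.
by rewrite !mulr_sumr -big_split ler_sum// => j _; exact: cost_convex.
Qed.

(** * The expected one-period cost *)

Section expected_cost.
Context (R : realType) (h p Dbar : R) (P : probability R R).
Hypotheses (h_gt0 : 0 < h) (p_gt0 : 0 < p).
Hypothesis P_supp : P `[0, Dbar]%classic = 1%E.

Definition expected_cost (y : R) : R := \int[P]_u cost h p y u.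

Local Notation g := expected_cost.
Let S : set R := `[0, Dbar]%classic.

Let mS : measurable S. Proof. exact: measurable_itv. Qed.

Let PCS : P (~` S) = 0%E.
Proof. by rewrite probability_setC// P_supp subee. Qed.

Let setTDCS : [set: R] `\` ~` S = S. Proof. by rewrite setDE setCK setTI. Qed.

Lemma ge0_integral_support (f : R -> \bar R) : measurable_fun [set: R] f ->
  (forall u, 0 <= f u)%E -> (\int[P]_u f u = \int[P]_(u in `[0%R, Dbar]) f u)%E.
Proof.
move=> mf f_ge0; rewrite (ge0_negligible_integral (N := ~` S))// ?setTDCS//.
exact: measurableC.
Qed.

(** The cost is unbounded over all real demands; a bound on the support is combined with the nullity
    of its complement. *)
Lemma integrable_cost y : P.-integrable [set: R] (EFin \o cost h p y).
Proof.
have mc := measurable_cost_demand h p y.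
apply/(negligible_integrable (N := ~` S)) => //; first exact: measurableC.
  exact/measurable_EFinP.
rewrite setTDCS; apply: measurable_bounded_integrable => //.
- by rewrite (le_lt_trans (probability_le1 P mS)) ?ltry.
- exact: measurable_funS mc.
exists (h * `|y| + p * (`|y| + Dbar)); split; first exact: num_real.
move=> b lt_b u; rewrite /S/= in_itv/= => /andP[u_ge0 u_le].
rewrite ger0_norm ?cost_ge0// ltW//; apply: le_lt_trans lt_b.
apply: lerD; rewrite ler_wpM2l ?(ltW h_gt0) ?(ltW p_gt0)//; rewrite ge_max.
  by have := ler_norm y; have := normr_ge0 y; lra.
by have := ler_norm (- y); rewrite normrN; have := normr_ge0 y; lra.
Qed.

Lemma expected_costE y : (\int[P]_u (cost h p y u)%:E = (g y)%:E)%E.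
Proof.
rewrite /expected_cost /Rintegral fineK// integrable_fin_num//.
exact: integrable_cost.
Qed.

Lemma expected_cost_ge0 y : 0 <= g y.
Proof. by apply: Rintegral_ge0 => u _; exact: cost_ge0. Qed.

Lemma expected_cost_diffE s r :
  \int[P]_u (cost h p s u - cost h p r u) = g s - g r.
Proof. by rewrite RintegralB//; exact: integrable_cost. Qed.

Lemma expected_cost_diff_bounds s r : s <= r ->
  - (h * (r - s)) <= g s - g r <= p * (r - s).
Proof.
move=> sr; rewrite -expected_cost_diffE; apply: Rintegral_bounds => [|u].
  exact: (integrableB _ (integrable_cost s) (integrable_cost r)).
exact: cost_diff_bounds.
Qed.

Lemma expected_cost_lipschitz x y : `|g x - g y| <= (h + p) * `|x - y|.
Proof.
wlog xy : x y / x <= y.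
  by move=> H; have [/H//|/ltW/H] := leP x y; rewrite distrC (distrC y).
have := expected_cost_diff_bounds xy; have := ler_wpM2l (ltW p_gt0) xy.
have := ler_wpM2l (ltW h_gt0) xy.
by rewrite ler_norml distrC ger0_norm ?subr_ge0//; lra.
Qed.

Lemma expected_cost_continuous : continuous g.
Proof.
have hp_gt0 : 0 < h + p by rewrite addr_gt0.
move=> x; apply/cvgrPdist_lt => e e_gt0; near=> y.
apply: le_lt_trans (expected_cost_lipschitz x y) _.
rewrite mulrC -ltr_pdivlMr//; near: y.
by apply/nbhs_ballP; exists (e / (h + p)); rewrite /= ?divr_gt0.
Unshelve. all: by end_near. Qed.

Lemma expected_cost_between a b c : a <= b -> b <= c ->
  g b <= Num.max (g a) (g c).
Proof.
move=> ab bc; apply: le_max_of_convex => //.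
have scaled k y : P.-integrable [set: R] (EFin \o (fun u => k * cost h p y u)).
  exact: (integrableZl measurableT k (integrable_cost y)).
rewrite -!RintegralZl//; try exact: integrable_cost.
rewrite -RintegralD//; apply: le_Rintegral => //.
  exact: (integrableD measurableT (scaled _ _) (scaled _ _)).
by move=> u _; exact: cost_convex.
Qed.

(** The extreme value theorem gives a minimizer on [[0, Dbar]], and clipping shows that it is
    global. Policies may choose levels above [Dbar], so they are compared with the minimum over all
    reals. *)
Lemma expected_cost_min : 0 < Dbar ->
  exists2 s, s \in `[0, Dbar] & forall y, g s <= g y.
Proof.
move=> Dbar_gt0.
have [s s0D s_min] := @EVT_min R g 0 Dbar (ltW Dbar_gt0)
  (continuous_subspaceT expected_cost_continuous).
exists s => // y; set y' := Num.min (Num.max y 0) Dbar.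
apply: (@le_trans _ _ (g y')).
  by apply: s_min; rewrite in_itv/= /y' ge_min le_min le_max !lexx !orbT ltW.
have mc z : measurable_fun [set: R] (fun u => (cost h p z u)%:E).
  by apply/measurable_EFinP; exact: measurable_cost_demand.
have c_ge0 z u : (0 <= (cost h p z u)%:E)%E by rewrite lee_fin cost_ge0.
rewrite -lee_fin -!expected_costE !ge0_integral_support//.
apply: ge0_le_integral => //; try exact: measurable_funTS.
by move=> u; rewrite /= in_itv/= => u0D; rewrite lee_fin cost_outside_support.
Qed.
End expected_cost.

(** * Dynamic programming bounds *)

(* f2 will be the value of an arbitrary policy as a function of the order,
   which is not known to be measurable. *)
Lemma ge0_le_integral_nonmeasurable d (T : measurableType d) (R : realType)
    (mu : {measure set T -> \bar R}) (f1 f2 : T -> \bar R) :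
  (forall x, 0 <= f1 x)%E -> (forall x, f1 x <= f2 x)%E ->
  (\int[mu]_x f1 x <= \int[mu]_x f2 x)%E.
Proof.
move=> f1_ge0 f12.
have f2_ge0 x : (0 <= f2 x)%E by exact: le_trans (f12 x).
rewrite !ge0_integralTE//; apply: le_ereal_sup => _ [k /= kf1 <-].
by exists k => // x; exact: le_trans (f12 x).
Qed.

Lemma probability_integral_cst d (T : measurableType d) (R : realType)
    (P : probability T R) (c : \bar R) : (\int[P]_x c = c)%E.
Proof.
rewrite (integral_cst P measurableT) -[RHS]mule1; congr (_ * _)%E.
exact: probability_setT.
Qed.

Section dynamics.
Context (R : realType) (m : inventory_model).
Context (h p Dbar : R) (P : probability R R).
Hypotheses (h_gt0 : 0 < h) (p_gt0 : 0 < p).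
Hypothesis P_supp : P `[0, Dbar]%classic = 1%E.

Local Notation g := (expected_cost h p P).

(* The state z - u forgets all orders: the level max z s restores them, so that
   this is the cost of the base-stock policy s in both models. *)
Fixpoint cost_to_go (s : R) (n : nat) (z : R) : \bar R :=
  if n is n'.+1 then
    ((g (Num.max z s))%:E + \int[P]_u cost_to_go s n' (z - u))%E
  else 0%E.

Lemma cost_to_go_ge0 s n z : (0 <= cost_to_go s n z)%E.
Proof.
elim: n z => [|n IHn] z //=; rewrite adde_ge0 ?integral_ge0//.
by rewrite lee_fin (expected_cost_ge0 _ h_gt0 p_gt0).
Qed.

Lemma measurable_cost_to_go s n : measurable_fun [set: R] (cost_to_go s n).
Proof.
elim: n => [|n IHn] /=; first exact: measurable_cst.
apply: emeasurable_funD.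
  apply/measurable_EFinP; apply: measurableT_comp; last exact: measurable_maxr.
  apply: continuous_measurable_fun.
  exact: (expected_cost_continuous h_gt0 p_gt0 P_supp).
apply: (@measurable_fun_fubini_tonelli_F _ _ R R R P
  (fun z => cost_to_go s n (z.1 - z.2))) => [/=|z]; last exact: cost_to_go_ge0.
apply: measurableT_comp => //; exact: measurable_funB.
Qed.

Lemma measurable_cost_to_go_shift s n z :
  measurable_fun [set: R] (fun u => cost_to_go s n (z - u)).
Proof.
apply: measurableT_comp; first exact: measurable_cost_to_go.
exact: measurable_funB.
Qed.

(** [c] is the cost already accumulated and [L] the continuation value; nonnegativity splits the
    integral even if [L] is not integrable. *)
Lemma integral_stage (c y : R) (L : R -> \bar R) : 0 <= c ->
  measurable_fun [set: R] L -> (forall u, 0 <= L u)%E ->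
  (\int[P]_u ((c + cost h p y u)%:E + L u) = (c + g y)%:E + \int[P]_u L u)%E.
Proof.
move=> c_ge0 mL L_ge0; have mc := measurable_cost_demand h p y.
have cost0 := cost_ge0 h_gt0 p_gt0 y.
rewrite ge0_integralD//; last 2 first.
- by move=> u _; rewrite lee_fin addr_ge0.
- by apply/measurable_EFinP; apply: measurable_funD.
congr (_ + _)%E; under eq_integral do rewrite EFinD.
rewrite ge0_integralD//; last 2 first.
- by move=> u _; rewrite lee_fin.
- by apply/measurable_EFinP.
rewrite (expected_costE h_gt0 p_gt0 P_supp).
by rewrite probability_integral_cst EFinD.
Qed.

Lemma total_cost_cons r w :
  total_cost h p (r :: w) = total_cost h p w + cost h p r.1.2 r.2.
Proof. by rewrite /total_cost big_cons addrC. Qed.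

Lemma total_cost_ge0 w : 0 <= total_cost h p w.
Proof. by apply: sumr_ge0 => r _; exact: cost_ge0. Qed.

Local Notation F := (fun w => (total_cost h p w)%:E).

Lemma expect_trajectory_ge0 pi n t (w : t.-tuple period) x :
  (0 <= expect_trajectory m P pi F n w x)%E.
Proof.
elim: n t w x => [|n IHn] t w x /=; first by rewrite lee_fin total_cost_ge0.
by apply: integral_ge0 => y _; apply: integral_ge0 => u _; exact: IHn.
Qed.

(** For [u >= 0], [Num.max (z - u) s] depends on [z] only through [Num.max z s]; the integrals are
    therefore first restricted to the support. *)
Lemma cost_to_go_max s n z z' : Num.max z s = Num.max z' s ->
  cost_to_go s n z = cost_to_go s n z'.
Proof.
elim: n z z' => [|n IHn] z z' //= zz'; rewrite zz'; congr (_ + _)%E.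
have mK v := measurable_cost_to_go_shift s n v.
rewrite !(ge0_integral_support P_supp)//; try by move=> u; exact: cost_to_go_ge0.
apply: eq_integral => u; rewrite inE/= in_itv/= => /andP[u_ge0 _].
apply: IHn; move: zz'; case: (leP z s) => zs; case: (leP z' s) => z's;
case: (leP (z - u) s) => zus; case: (leP (z' - u) s) => zus'; lra.
Qed.

Lemma measurable_next_state :
  measurable_fun [set: R * R] (fun z => next_state m z.1 z.2).
Proof.
case: m => /=; first exact: measurable_funB.
by apply: measurable_maxr => //; exact: measurable_funB.
Qed.

(** The lost-sales truncation at 0 is absorbed by [s >= 0], and when [x <= s] both sides equal [s].
    This is what makes the two models agree. *)
Lemma max_next_state (s x u : R) : 0 <= s -> 0 <= u ->
  Num.max (next_state m (Num.max x s) u) s = Num.max (x - u) s.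
Proof.
move=> s_ge0 u_ge0.
have -> : Num.max (next_state m (Num.max x s) u) s =
    Num.max (Num.max x s - u) s.
  by rewrite /next_state; case: (m) => //; rewrite -maxA (max_r s_ge0).
by have [xs|sx] := leP x s; rewrite // !max_r//; lra.
Qed.

(** The induction carries the cost of the elapsed periods [w], since the total is evaluated only at
    the end of the trajectory. *)
Lemma base_stock_value s n t (w : t.-tuple period) x : 0 <= s ->
  expect_trajectory m P (base_stock s) F n w x
    = ((total_cost h p w)%:E + cost_to_go s n x)%E.
Proof.
move=> s_ge0; elim: n t w x => [|n IHn] t w x /=; first by rewrite adde0.
have C_ge0 := total_cost_ge0 w; set C := total_cost h p w in C_ge0 *.
(* The inner integral as a function of the level: once measurable, its integral against the Dirac
   kernel is its value at [Num.max x s]. *)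
pose J y := (\int[P]_u
  ((C + cost h p y u)%:E + cost_to_go s n (next_state m y u)))%E.
have mK : measurable_fun [set: R * R]
    (fun z => cost_to_go s n (next_state m z.1 z.2)).
  by apply: measurableT_comp; [exact: measurable_cost_to_go|exact: measurable_next_state].
have mKx : measurable_fun [set: R]
    (fun u => cost_to_go s n (next_state m (Num.max x s) u)).
  exact: (measurableT_comp mK (pair1_measurable (Num.max x s))).
have mJ : measurable_fun [set: R] J.
  apply: (@measurable_fun_fubini_tonelli_F _ _ R R R P
    (fun z => (C + cost h p z.1 z.2)%:E +
      cost_to_go s n (next_state m z.1 z.2))%E).
    apply: emeasurable_funD => //; apply/measurable_EFinP.
    by apply: measurable_funD => //; exact: measurable_cost.
  by move=> z; rewrite adde_ge0 ?cost_to_go_ge0// lee_fin addr_ge0// cost_ge0.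
under eq_integral => y _.
  rewrite (_ : integral _ _ _ = J y); last first.
    by apply: eq_integral => u _; rewrite IHn total_cost_cons.
  over.
rewrite /base_stock /kdirac/= integral_dirac// diracT mul1e /J.
rewrite integral_stage//; last by move=> u; exact: cost_to_go_ge0.
rewrite EFinD -addeA; congr (_ + (_ + _))%E.
have mx v := measurable_cost_to_go_shift s n v.
rewrite !(ge0_integral_support P_supp)//; try by move=> u; exact: cost_to_go_ge0.
apply: eq_integral => u; rewrite inE/= in_itv/= => /andP[u_ge0 _].
by apply: cost_to_go_max; exact: max_next_state.
Qed.

Variable sopt : R.
Hypothesis sopt_min : forall y, g sopt <= g y.

Lemma expected_cost_ge_sopt y z : sopt <= y -> y <= z -> g y <= g z.
Proof.
move=> sy yz; have := expected_cost_between h_gt0 p_gt0 P_supp sy yz.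
by rewrite max_r.
Qed.

Lemma expected_cost_le_sopt y z : y <= z -> z <= sopt -> g z <= g y.
Proof.
move=> yz zs; have := expected_cost_between h_gt0 p_gt0 P_supp yz zs.
by rewrite max_l.
Qed.

(** Every stage evaluates [g] at or above [sopt], where [g] is nondecreasing. *)
Lemma le_cost_to_go n z z' : z <= z' ->
  (cost_to_go sopt n z <= cost_to_go sopt n z')%E.
Proof.
elim: n z z' => [|n IHn] z z' //= zz'; apply: leeD.
  rewrite lee_fin; apply: expected_cost_ge_sopt; first by rewrite le_max lexx orbT.
  by rewrite ge_max !le_max zz' lexx orbT.
apply: ge0_le_integral_nonmeasurable => u; first exact: cost_to_go_ge0.
by apply: IHn; rewrite lerB.
Qed.

(** A feasible order [y >= Num.max x 0] costs at least [g (Num.max x sopt)] and leads to a state at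
    least [x - u] in both models; monotonicity of [cost_to_go] closes the induction. *)
Lemma feasible_value_ge pi n t (w : t.-tuple period) x : feasible pi ->
  ((total_cost h p w)%:E + cost_to_go sopt n x
    <= expect_trajectory m P pi F n w x)%E.
Proof.
move=> pi_feasible; elim: n t w x => [|n IHn] t w x /=; first by rewrite adde0.
set A := [set y | Num.max x 0 <= y].
have mA : measurable A.
  rewrite (_ : A = `[Num.max x 0, +oo[%classic) //.
  by apply/seteqP; split => y; rewrite /= in_itv/= andbT.
set c0 := (_ + _)%E; set i := (X in pi t X).
have c0_ge0 : (0 <= c0)%E.
  by rewrite adde_ge0 ?lee_fin ?total_cost_ge0//; exact: (cost_to_go_ge0 sopt n.+1 x).
(* The feasible levels [A] have kernel mass one, so it suffices to bound the integrand below by [c0]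
   on [A] and by 0 elsewhere. *)
apply: (@le_trans _ _ (\int[pi t i]_y ((cst c0) \_ A) y)%E).
  rewrite -integral_mkcond integral_cst// (pi_feasible t i) mule1//.
apply: ge0_le_integral_nonmeasurable => y; first exact: erestrict_ge0.
rewrite patchE; case: ifPn => [/set_mem|_]; last first.
  by apply: integral_ge0 => u _; exact: expect_trajectory_ge0.
rewrite /A/= ge_max => /andP[xy y_ge0].
apply: (@le_trans _ _ (\int[P]_u
    ((total_cost h p w + cost h p y u)%:E + cost_to_go sopt n (x - u))))%E; last first.
  apply: ge0_le_integral_nonmeasurable => u.
    by rewrite adde_ge0 ?cost_to_go_ge0// lee_fin addr_ge0 ?total_cost_ge0 ?cost_ge0.
  apply: (le_trans _ (IHn _ _ _)); rewrite total_cost_cons leeD// le_cost_to_go//.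
  apply: (@le_trans _ _ (y - u)); first by rewrite lerB.
  by case: (m) => //=; rewrite le_max lexx.
rewrite integral_stage ?total_cost_ge0//; last 2 first.
- exact: measurable_cost_to_go_shift.
- by move=> u; exact: cost_to_go_ge0.
rewrite /c0 EFinD -addeA leeD2l// leeD2r// lee_fin.
have [xs|sx] := leP x sopt; first by [].
by apply: expected_cost_ge_sopt => //; exact: ltW.
Qed.

Lemma cost_to_go_le s n z :
  (cost_to_go s n z <= cost_to_go sopt n z + (n%:R * (g s - g sopt))%:E)%E.
Proof.
have dge0 : 0 <= g s - g sopt by rewrite subr_ge0.
elim: n z => [|n IHn] z /=; first by rewrite mul0r adde0.
have mK v := measurable_cost_to_go_shift v n z.
(* If [z] exceeds both levels, the two orders coincide. Otherwise [g (Num.max z s)] is at most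
   [g s], while [g (Num.max z sopt)] is at least [g sopt]. *)
have stage_le : g (Num.max z s) <= g (Num.max z sopt) + (g s - g sopt).
  have [ss|/ltW ss] := leP s sopt.
    have [zs|/ltW sz] := leP z sopt; last first.
      by rewrite max_l ?(le_trans ss)// lerDl.
    rewrite subrKC; apply: expected_cost_le_sopt; first by rewrite le_max lexx orbT.
    by rewrite ge_max zs.
  have [zs|/ltW sz] := leP z s; last first.
    by rewrite max_l ?(le_trans ss)// lerDl.
  by have := sopt_min (Num.max z sopt); lra.
apply: (@le_trans _ _ ((g (Num.max z sopt) + (g s - g sopt))%:E +
    \int[P]_u (cost_to_go sopt n (z - u) + (n%:R * (g s - g sopt))%:E))%E).
  apply: leeD; first by rewrite lee_fin.
  by apply: ge0_le_integral_nonmeasurable => u; rewrite ?cost_to_go_ge0.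
rewrite ge0_integralD//; last 2 first.
- by move=> u _; exact: cost_to_go_ge0.
- by move=> u _; rewrite lee_fin mulr_ge0.
rewrite probability_integral_cst.
move: (integral P _ _) => I; set a := g (Num.max z sopt); set e := g s - g sopt.
have -> : (n.+1%:R * e)%:E = (e%:E + (n%:R * e)%:E)%E.
  by rewrite -EFinD -natr1; congr EFin; ring.
by rewrite EFinD -!addeA leeD2l// addeCA.
Qed.

End dynamics.

(** * Regret of the empirical base-stock level *)

Section regret.
Context (R : realType) (m : inventory_model).
Context (h p Dbar : R) (P : probability R R).
Hypotheses (h_gt0 : 0 < h) (p_gt0 : 0 < p).
Hypothesis P_supp : P `[0, Dbar]%classic = 1%E.

Local Notation g := (expected_cost h p P).

Variable sopt : R.
Hypothesis sopt_min : forall y, g sopt <= g y.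

Lemma worst_regret_le (T : nat) (s : R) : 0 <= s ->
  (worst_regret m P h p Dbar T (base_stock s)
    <= (T%:R * (g s - g sopt))%:E)%E.
Proof.
move=> s_ge0; apply: ge_ereal_sup => _ [x _ <-].
have value0 : total_cost h p [tuple] = 0 by rewrite /total_cost big_nil.
rewrite /policy_value (base_stock_value m h_gt0 p_gt0 P_supp)// value0 add0e.
set V := optimal_value _ _ _ _ _ _.
have V_ge : (cost_to_go h p P sopt T x <= V)%E.
  apply: le_ereal_inf_tmp => _ [pi pi_feasible <-].
  have := feasible_value_ge m h_gt0 p_gt0 P_supp sopt_min T [tuple] x pi_feasible.
  by rewrite value0 add0e.
have V_ge0 : (0 <= V)%E by apply: le_trans V_ge; exact: cost_to_go_ge0.
have := cost_to_go_le h_gt0 p_gt0 P_supp sopt_min s T x.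
(* Being nonnegative, [V] is finite or [+oo]; in the latter case the difference is [-oo]. *)
case: V V_ge V_ge0 => [v| |]// V_ge _ K_le.
- by rewrite leeBlDr// (le_trans K_le)// addeC leeD2l.
- by rewrite addeNy leNye.
Qed.
End regret.

(** * Deviation of the empirical minimizer *)

Section deviation.
Context (R : realType) (h p Dbar : R) (P : probability R R).
Context d (Omega : measurableType d) (Q : probability Omega R).
Context (M : nat) (D : 'I_M -> {RV Q >-> R}).
Hypotheses (Dbar_gt0 : 0 < Dbar) (h_gt0 : 0 < h) (p_gt0 : 0 < p).
Hypothesis P_supp : P `[0, Dbar]%classic = 1%E.
Hypotheses (M_gt0 : (0 < M)%N) (D_iid : iid_sample P D).

Local Notation g := (expected_cost h p P).
Local Notation emp w := (empirical_cost h p (fun j => D j w)).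

(** Hoeffding's inequality for [f], of mean [- eps]: a misordering by the empirical cost forces the
    sum of [f] to be nonnegative, a deviation of [eps] per observation. *)
Lemma empirical_misorder s r eps : `|r - s| <= Dbar -> 0 <= eps ->
  g r = g s + eps ->
  exists2 B : set Omega, measurable B /\ (Q B <=
    (expR (- (2 * M%:R * eps ^+ 2 / ((h + p) * Dbar) ^+ 2)))%:E)%E &
    forall w, emp w r <= emp w s -> B w.
Proof.
move=> rs eps_ge0 grE; pose f u := cost h p s u - cost h p r u.
have mf : measurable_fun [set: R] f.
  by apply: measurable_funB; exact: measurable_cost_demand.
have fE : \int[P]_u f u = - eps.
  by rewrite (expected_cost_diffE h_gt0 p_gt0 P_supp) grE; lra.
have b_gt0 : 0 < (h + p) * Dbar by rewrite mulr_gt0 ?addr_gt0.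
have [a f_ab] : exists a, forall u, a <= f u <= a + (h + p) * Dbar.
  have [sr|/ltW sr] := leP s r.
    move: rs; rewrite ger0_norm ?subr_ge0// => rs.
    exists (- (h * (r - s))) => u.
    have /andP[fl fu] := cost_diff_bounds h_gt0 p_gt0 u sr.
    rewrite fl/= (le_trans fu)//.
    have := ler_wpM2l (ltW h_gt0) rs; have := ler_wpM2l (ltW p_gt0) rs; lra.
  move: rs; rewrite distrC ger0_norm ?subr_ge0// => rs.
  exists (- (p * (s - r))) => u.
  have /andP[fl fu] := cost_diff_bounds h_gt0 p_gt0 u sr.
  apply/andP; split; rewrite /f; first lra.
  have := ler_wpM2l (ltW h_gt0) rs; have := ler_wpM2l (ltW p_gt0) rs; lra.
have tail := hoeffding_tail D_iid mf b_gt0 f_ab eps_ge0.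
rewrite fE addNr mulr0 in tail.
eexists; first split; [|exact: tail|].
  exact: measurable_sum_ge.
move=> w /=; rewrite /empirical_cost ler_pM2l ?invr_gt0 ?ltr0n// => le_rs.
by rewrite sumrB subr_ge0.
Qed.

Variable sopt : R.
Hypothesis sopt_min : forall y, g sopt <= g y.
Hypothesis sopt_in : sopt \in `[0, Dbar].

(** Betweenness regardless of the order of the end points, so that both sides of [sopt] share one
    argument. *)
Let between (x y z : R) := (x <= y <= z) || (z <= y <= x).

Let expected_between x y z : between x y z -> g y <= Num.max (g x) (g z).
Proof.
by case/orP => /andP[xy yz]; [|rewrite maxC];
  exact: (expected_cost_between h_gt0 p_gt0 P_supp).
Qed.

Let empirical_between w x y z : between x y z ->
  emp w y <= Num.max (emp w x) (emp w z).
Proof.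
by case/orP => /andP[xy yz]; [|rewrite maxC]; exact: empirical_cost_between.
Qed.

(** [B] is chosen before [s]: the misordering of [sopt] and a single level [r] controls all levels
    between [sopt] and [e], without a union bound over [s]. *)
Lemma one_sided_deviation e eps : e \in `[0, Dbar] -> 0 < eps ->
  exists2 B : set Omega, measurable B /\ (Q B <=
    (expR (- (2 * M%:R * eps ^+ 2 / ((h + p) * Dbar) ^+ 2)))%:E)%E &
    forall w s, between sopt s e -> emp w s <= emp w sopt -> ~ B w ->
      g s <= g sopt + eps.
Proof.
move=> e_in eps_gt0.
have [[s0 [s0_between s0_gt]]|no_bad] :=
    pselect (exists s, between sopt s e /\ g sopt + eps < g s); last first.
  exists set0; first by rewrite measure0 lee_fin expR_ge0.
  move=> w s s_between _ _; rewrite leNgt; apply/negP => s_gt.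
  by apply: no_bad; exists s.
(* The intermediate value theorem between [sopt] and the bad level [s0] makes the excess exactly
   [eps]. *)
have [r r_between rE] : exists2 r, between sopt r s0 & g r = g sopt + eps.
  have cg a b : {within `[a, b], continuous g}.
    apply: continuous_subspaceT.
    exact: (expected_cost_continuous h_gt0 p_gt0 P_supp).
  have lo : g sopt <= g sopt + eps by rewrite lerDl ltW.
  have [le0|/ltW le0] := leP sopt s0.
    have [|r] := @IVT R g sopt s0 (g sopt + eps) le0 (cg _ _).
      by rewrite ge_min lo le_max (ltW s0_gt) orbT.
    by rewrite in_itv/= => r_in rE; exists r => //; rewrite /between r_in.
  have [|r] := @IVT R g s0 sopt (g sopt + eps) le0 (cg _ _).
    by rewrite ge_min lo le_max (ltW s0_gt) orbT.
  by rewrite in_itv/= => r_in rE; exists r => //; rewrite /between r_in orbT.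
have r_dist : `|r - sopt| <= Dbar.
  move: e_in sopt_in s0_between r_between; rewrite !in_itv/= /between.
  move=> /andP[? ?] /andP[? ?] /orP[]/andP[? ?] /orP[]/andP[? ?].
  - by rewrite ler_norml; lra.
  - by rewrite ler_norml; lra.
  - by rewrite ler_norml; lra.
  - by rewrite ler_norml; lra.
have [B BQ B_misorder] := empirical_misorder r_dist (ltW eps_gt0) rE.
exists B => // w s s_between emp_le nB; rewrite leNgt; apply/negP => s_gt.
(* Both levels lie on the same side of [sopt]. If [s] comes first, quasiconvexity of [g] contradicts
   [s_gt]; if [r] does, quasiconvexity of the empirical cost puts [w] in [B]. *)
have [s_sr|r_ss] : between sopt s r \/ between sopt r s.
  move: s_between r_between s0_between; rewrite /between.
  move=> /orP[]/andP[? ?] /orP[]/andP[? ?] /orP[]/andP[? ?];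
  have [?|/ltW ?] := leP s r;
  first [left; apply/orP; left; apply/andP; split; lra
     |left; apply/orP; right; apply/andP; split; lra
     |right; apply/orP; left; apply/andP; split; lra
     |right; apply/orP; right; apply/andP; split; lra].
  have := expected_between s_sr; rewrite rE max_r; first by rewrite leNgt s_gt.
  by rewrite lerDl ltW.
apply/nB/B_misorder; have := empirical_between w r_ss.
by rewrite max_l.
Qed.
End deviation.

(** * High-probability regret bound and sample size *)

Lemma sample_size_bound (R : realType) (k D T eps L M : R) :
  0 <= k -> 0 <= D -> 0 <= T -> 0 < eps -> 0 <= L -> 0 < M ->
  2 * k ^+ 2 * D ^+ 2 * T ^+ 2 * eps ^- 2 * L <= M ->
  2 * T * k * D * Num.sqrt (L / (2 * M)) <= eps.
Proof.
move=> k_ge0 D_ge0 T_ge0 eps_gt0 L_ge0 M_gt0 M_ge.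
have X_ge0 : 0 <= L / (2 * M) by rewrite divr_ge0 ?mulr_ge0// ltW.
rewrite -(@ler_pXn2r _ 2)// ?nnegrE ?mulr_ge0 ?sqrtr_ge0 ?(ltW eps_gt0)//.
rewrite exprMn sqr_sqrtr//.
have -> : (2 * T * k * D) ^+ 2 * (L / (2 * M))
    = (2 * k ^+ 2 * D ^+ 2 * T ^+ 2 * eps ^- 2 * L) * eps ^+ 2 / M.
  by field; rewrite !gt_eqF.
by rewrite ler_pdivrMr// mulrC ler_wpM2l// sqr_ge0.
Qed.

Theorem corollary2 (R : realType) (m : inventory_model) (T : nat)
    (Dbar h p : R) (P : probability R R)
    (d : measure_display) (Omega : measurableType d) (Q : probability Omega R)
    (M : nat) (D : 'I_M -> {RV Q >-> R}) (shat : Omega -> R) (eta : R)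
    (Dbar_gt0 : 0 < Dbar) (h_gt0 : 0 < h) (p_gt0 : 0 < p)
    (P_supp : P `[0, Dbar]%classic = 1%E)
    (M_gt0 : (0 < M)%N) (D_iid : iid_sample P D)
    (shat_min : forall omega, minimizes `[0, Dbar]%classic
       (empirical_cost h p (fun j => D j omega)) (shat omega))
    (eta_gt0 : 0 < eta) (eta_lt1 : eta < 1) :
  with_probability_at_least Q (1 - eta)
    [set omega | (worst_regret m P h p Dbar T (base_stock (shat omega)) <=
       (2 * T%:R * Num.max h p * Dbar
          * Num.sqrt (ln (2 / eta) / (2 * M%:R)))%:E)%E]
  /\
  forall eps : R, 0 < eps ->
    2 * Num.max h p ^+ 2 * Dbar ^+ 2 * T%:R ^+ 2 * eps ^- 2 * ln (2 / eta)
      <= M%:R ->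
    with_probability_at_least Q (1 - eta)
      [set omega | (worst_regret m P h p Dbar T (base_stock (shat omega))
         <= eps%:E)%E].

Proof.
set L := ln (2 / eta); set X := L / (2 * M%:R).
have M_gt0' : 0 < M%:R :> R by rewrite ltr0n.
have L_gt0 : 0 < L by rewrite ln_gt0// ltr_pdivlMr//; lra.
have X_gt0 : 0 < X by rewrite divr_gt0// mulr_gt0.
have b_gt0 : 0 < (h + p) * Dbar by rewrite mulr_gt0 ?addr_gt0.
set bound := 2 * T%:R * Num.max h p * Dbar * Num.sqrt X.
suff main : with_probability_at_least Q (1 - eta)
    [set w | (worst_regret m P h p Dbar T (base_stock (shat w)) <= bound%:E)%E].
  split=> // eps eps_gt0 M_ge; have [A [mA A_sub QA]] := main.
  exists A; split=> // w /A_sub /= /le_trans; apply; rewrite lee_fin.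
  apply: sample_size_bound M_ge => //; [|exact: ltW|exact: ltW].
  by rewrite le_max ltW.
have [sopt sopt_in sopt_min] := expected_cost_min h_gt0 p_gt0 P_supp Dbar_gt0.
(* The excess for which the Hoeffding bound on each side of [sopt] equals [eta / 2]. *)
pose eps := (h + p) * Dbar * Num.sqrt X.
have eps_gt0 : 0 < eps by rewrite mulr_gt0// sqrtr_gt0.
have expE : expR (- (2 * M%:R * eps ^+ 2 / ((h + p) * Dbar) ^+ 2)) = eta / 2.
  have -> : 2 * M%:R * eps ^+ 2 / ((h + p) * Dbar) ^+ 2 = L.
    rewrite /eps exprMn sqr_sqrtr ?ltW// /X; field.
    by rewrite !gt_eqF ?addr_gt0.
  by rewrite expRN /L lnK ?posrE ?divr_gt0// invf_div.
have in0 : 0 \in `[0, Dbar] by rewrite in_itv/= lexx ltW.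
have inD : Dbar \in `[0, Dbar] by rewrite in_itv/= lexx ltW.
have [B0 [mB0 QB0] B0_good] := one_sided_deviation Dbar_gt0 h_gt0 p_gt0 P_supp
  M_gt0 D_iid sopt_in in0 eps_gt0.
have [BD [mBD QBD] BD_good] := one_sided_deviation Dbar_gt0 h_gt0 p_gt0 P_supp
  M_gt0 D_iid sopt_in inD eps_gt0.
rewrite expE in QB0 QBD.
exists (~` (B0 `|` BD)); split; first by apply: measurableC; exact: measurableU.
- move=> w /not_orP[nB0 nBD] /=.
  have [] := shat_min w; rewrite /= in_itv/= => /andP[s_ge0 s_le] s_emp.
  have emp_le := s_emp _ sopt_in.
  have g_le : expected_cost h p P (shat w) <= expected_cost h p P sopt + eps.
    move: sopt_in; rewrite in_itv/= => /andP[sopt_ge0 sopt_le].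
    have [ss|/ltW ss] := leP (shat w) sopt.
      by apply: (B0_good w) => //; rewrite s_ge0 ss orbT.
    by apply: (BD_good w) => //; rewrite ss s_le.
  apply: (le_trans (worst_regret_le m h_gt0 p_gt0 P_supp sopt_min T s_ge0)).
  rewrite lee_fin; apply: (@le_trans _ _ (T%:R * eps)).
    by rewrite ler_wpM2l// lerBlDl.
  rewrite (_ : bound = T%:R * (2 * Num.max h p * (Dbar * Num.sqrt X))); last first.
    by rewrite /bound; ring.
  rewrite ler_wpM2l// /eps -mulrA ler_wpM2r ?mulr_ge0 ?sqrtr_ge0 ?(ltW Dbar_gt0)//.
  (* The factor 2 of the bound comes from [h + p <= 2 * Num.max h p]. *)
  by rewrite mulr_natl mulr2n lerD// le_max lexx ?orbT.
- rewrite probability_setC; last exact: measurableU.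
  rewrite EFinB leeB//.
  apply: le_trans (measureU2 _ mB0 mBD) _.
  by rewrite [eta]splitr EFinD leeD.
Qed.
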